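(* Let $\mathcal{C}$ be a strict braided monoidal category with braiding $c$ and $(A,\mu,u)$ an algebra in $\mathcal{C}$. Then $T:=c_{A,A}^2=c_{A,A}\circ c_{A,A}$ is a pseudotwistor for $A$ in $\mathcal{C}$. In particular, $(A,\mu\circ c_{A,A}^2,u)$ is an algebra in $\mathcal{C}$.
   Context: The identity morphism of an object $A$ is denoted by $A$; algebras in $\mathcal{C}$ are associative and unital. A pseudotwistor for an algebra $(A,\mu,u)$ in a strict monoidal category is a morphism $T:A\otimes A\to A\otimes A$ with $T\circ(u\otimes A)=u\otimes A$, $T\circ(A\otimes u)=A\otimes u$, for which there exist morphisms (companions) $\tilde{T}_1,\tilde{T}_2:A\otimes A\otimes A\to A\otimes A\otimes A$ such that $(A\otimes\mu)\circ\tilde{T}_1\circ(T\otimes A)=T\circ(A\otimes\mu)$, $(\mu\otimes A)\circ\tilde{T}_2\circ(A\otimes T)=T\circ(\mu\otimes A)$ and $\tilde{T}_1\circ(T\otimes A)\circ(A\otimes T)=\tilde{T}_2\circ(A\otimes T)\circ(T\otimes A)$. *)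

(* Defs.v *)
From Corelib Require Import ssreflect.

Set Implicit Arguments.
Unset Strict Implicit.
Unset Printing Implicit Defensive.

Declare Scope cat_scope.
Delimit Scope cat_scope with cat.
Local Open Scope cat_scope.

Record category := Category {
  obj :> Type;
  hom : obj -> obj -> Type;
  idm : forall X : obj, hom X X;
  comp : forall X Y Z : obj, hom Y Z -> hom X Y -> hom X Z;
  compA : forall (X Y Z W : obj) (h : hom Z W) (g : hom Y Z) (f : hom X Y),
    comp h (comp g f) = comp (comp h g) f;
  comp1m : forall (X Y : obj) (f : hom X Y), comp (idm Y) f = f;
  compm1 : forall (X Y : obj) (f : hom X Y), comp f (idm X) = f
}.

Arguments hom {c} X Y.
Arguments idm {c} X.
Arguments comp {c X Y Z} g f.

Notation "g ∘ f" := (comp g f) (at level 50, left associativity) : cat_scope.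

(* The identity of X, read as a morphism to an object equal to X. By proof
   irrelevance it depends only on X and Y, not on the equality proof. *)
Definition idcast (C : category) (X Y : C) (e : X = Y) : hom X Y :=
  match e in _ = Z return hom X Z with eq_refl => idm X end.

Definition is_iso (C : category) (X Y : C) (f : hom X Y) : Prop :=
  exists g : hom Y X, g ∘ f = idm X /\ f ∘ g = idm Y.

(* In a strict monoidal category (X ⊗ Y) ⊗ Z and X ⊗ (Y ⊗ Z) are equal, but in
   general not convertible, so the identities between them are written idcast.
   The equations tensmA, tens1m and tensm1 express that (f ⊗ g) ⊗ h = f ⊗ (g ⊗ h),
   1 ⊗ f = f and f ⊗ 1 = f, or equivalently that idcast is a natural associator
   and unitor. The pentagon and triangle then hold by uniqueness of identity
   proofs. *)
Record strictMonoidalCat := StrictMonoidalCat {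
  smcat :> category;
  tens : smcat -> smcat -> smcat;
  one : smcat;
  tensm : forall X X' Y Y' : smcat,
    hom X X' -> hom Y Y' -> hom (tens X Y) (tens X' Y');
  tensm_id : forall X Y : smcat, tensm (idm X) (idm Y) = idm (tens X Y);
  tensm_comp : forall (X X' X'' Y Y' Y'' : smcat)
      (f' : hom X' X'') (f : hom X X') (g' : hom Y' Y'') (g : hom Y Y'),
    tensm (f' ∘ f) (g' ∘ g) = tensm f' g' ∘ tensm f g;
  tensA : forall X Y Z : smcat, tens (tens X Y) Z = tens X (tens Y Z);
  tens1o : forall X : smcat, tens one X = X;
  tenso1 : forall X : smcat, tens X one = X;
  tensmA : forall (X X' Y Y' Z Z' : smcat)
      (f : hom X X') (g : hom Y Y') (h : hom Z Z'),
    idcast (tensA X' Y' Z') ∘ tensm (tensm f g) h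
    = tensm f (tensm g h) ∘ idcast (tensA X Y Z);
  tens1m : forall (X X' : smcat) (f : hom X X'),
    idcast (tens1o X') ∘ tensm (idm one) f = f ∘ idcast (tens1o X);
  tensm1 : forall (X X' : smcat) (f : hom X X'),
    idcast (tenso1 X') ∘ tensm f (idm one) = f ∘ idcast (tenso1 X)
}.

Arguments tens {s} X Y.
Arguments one {s}.
Arguments tensm {s X X' Y Y'} f g.
Arguments tensA {s} X Y Z.
Arguments tens1o {s} X.
Arguments tenso1 {s} X.

Notation "X ⊗ Y" := (tens X Y) (at level 40, left associativity) : cat_scope.
Notation "f ⊗m g" := (tensm f g) (at level 40, left associativity) : cat_scope.

Definition asc (C : strictMonoidalCat) (X Y Z : C) :
    hom (X ⊗ Y ⊗ Z) (X ⊗ (Y ⊗ Z)) :=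
  idcast (tensA X Y Z).

Definition ascV (C : strictMonoidalCat) (X Y Z : C) :
    hom (X ⊗ (Y ⊗ Z)) (X ⊗ Y ⊗ Z) :=
  idcast (eq_sym (tensA X Y Z)).

Definition lun (C : strictMonoidalCat) (X : C) : hom (one ⊗ X) X :=
  idcast (tens1o X).

Definition run (C : strictMonoidalCat) (X : C) : hom (X ⊗ one) X :=
  idcast (tenso1 X).

(* X ⊗ g as an endomorphism of the left-bracketed X ⊗ Y ⊗ Z *)
Definition tensr (C : strictMonoidalCat) (X Y Z : C) (g : hom (Y ⊗ Z) (Y ⊗ Z)) :
    hom (X ⊗ Y ⊗ Z) (X ⊗ Y ⊗ Z) :=
  ascV X Y Z ∘ (idm X ⊗m g) ∘ asc X Y Z.

Arguments tensr {C} X {Y Z} g.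

Record braiding (C : strictMonoidalCat) := Braiding {
  braid :> forall X Y : C, hom (X ⊗ Y) (Y ⊗ X);
  braid_iso : forall X Y : C, is_iso (braid X Y);
  braid_nat : forall (X X' Y Y' : C) (f : hom X X') (g : hom Y Y'),
    braid X' Y' ∘ (f ⊗m g) = (g ⊗m f) ∘ braid X Y;
  braid_hexagonr : forall X Y Z : C,
    asc Y Z X ∘ braid X (Y ⊗ Z) ∘ asc X Y Z
    = (idm Y ⊗m braid X Z) ∘ asc Y X Z ∘ (braid X Y ⊗m idm Z);
  braid_hexagonl : forall X Y Z : C,
    ascV Z X Y ∘ braid (X ⊗ Y) Z ∘ ascV X Y Z
    = (braid X Z ⊗m idm Y) ∘ ascV X Z Y ∘ (idm X ⊗m braid Y Z)
}.

Record is_algebra (C : strictMonoidalCat) (A : C)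
    (mu : hom (A ⊗ A) A) (u : hom one A) : Prop := IsAlgebra {
  algA : mu ∘ (mu ⊗m idm A) = mu ∘ (idm A ⊗m mu) ∘ asc A A A;
  alg1m : mu ∘ (u ⊗m idm A) = lun A;
  algm1 : mu ∘ (idm A ⊗m u) = run A
}.

Record are_companions (C : strictMonoidalCat) (A : C) (mu : hom (A ⊗ A) A)
    (T : hom (A ⊗ A) (A ⊗ A)) (T1 T2 : hom (A ⊗ A ⊗ A) (A ⊗ A ⊗ A)) : Prop :=
  AreCompanions {
  companion1 :
    (idm A ⊗m mu) ∘ asc A A A ∘ T1 ∘ (T ⊗m idm A)
    = T ∘ (idm A ⊗m mu) ∘ asc A A A;
  companion2 :
    (mu ⊗m idm A) ∘ T2 ∘ tensr A T = T ∘ (mu ⊗m idm A);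
  companion12 :
    T1 ∘ (T ⊗m idm A) ∘ tensr A T = T2 ∘ tensr A T ∘ (T ⊗m idm A)
}.

Record is_pseudotwistor (C : strictMonoidalCat) (A : C) (mu : hom (A ⊗ A) A)
    (u : hom one A) (T : hom (A ⊗ A) (A ⊗ A)) : Prop := IsPseudotwistor {
  twist1m : T ∘ (u ⊗m idm A) = u ⊗m idm A;
  twistm1 : T ∘ (idm A ⊗m u) = idm A ⊗m u;
  twist_companions : exists T1 T2 : hom (A ⊗ A ⊗ A) (A ⊗ A ⊗ A),
    are_companions mu T T1 T2
}.

(* Main.v *)
Require Import Defs.
From Corelib Require Import ssreflect ssrbool.
From Stdlib Require Import ProofIrrelevance.

Set Implicit Arguments.
Unset Strict Implicit.
Unset Printing Implicit Defensive.

(** Put [s1 = c ⊗ A] and [s2 = A ⊗ c]. By naturality of [c] and the hexagons,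
    [T (A ⊗ μ) = (A ⊗ μ) s1 s2 s2 s1] and [T (μ ⊗ A) = (μ ⊗ A) s2 s1 s1 s2], so
    [s1 s2² s1^-1] and [s2 s1² s2^-1] satisfy the first two companion equations
    for [T = c²]. The third one becomes [s1 s2² s1 s2² = s2 s1² s2 s1²]: by the
    braid relation [s1 s2 s1 = s2 s1 s2] both sides are [(s1 s2 s1)²]. The unit
    conditions hold because braiding with the unit object is trivial. *)

Local Open Scope cat_scope.

Lemma iso_monic (C : category) (X Y Z : C) (f : hom Y Z) (g h : hom X Y) :
  is_iso f -> f ∘ g = f ∘ h -> g = h.
Proof.
by case=> f' [f'f _] /(f_equal (comp f')); rewrite !compA f'f !comp1m.
Qed.

Lemma iso_epic (C : category) (X Y Z : C) (f : hom X Y) (g h : hom Y Z) :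
  is_iso f -> g ∘ f = h ∘ f -> g = h.
Proof.
by case=> f' [_ ff'] /(f_equal (fun k => k ∘ f')); rewrite -!compA ff' !compm1.
Qed.

Lemma idcast_comp (C : category) (X Y Z : C) (e : X = Y) (e' : Y = Z) :
  idcast e' ∘ idcast e = idcast (eq_trans e e').
Proof. by case: Z / e'; rewrite comp1m. Qed.

(** This serves as coherence: once a composite of associators and unitors, possibly tensored with
    identities, is folded into a single [idcast], only its endpoints matter. *)
Lemma idcast_irrelevance (C : category) (X Y : C) (e e' : X = Y) :
  idcast e = idcast e'.
Proof. by rewrite (proof_irrelevance _ e e'). Qed.

Lemma idcast_iso (C : category) (X Y : C) (e : X = Y) : is_iso (idcast e).
Proof. by case: Y / e; exists (idm X); rewrite /= comp1m. Qed.

Section StrictMonoidal.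

Variable C : strictMonoidalCat.
Implicit Types X Y Z : C.

Lemma tensm_idcastl X Y Z (e : X = Y) :
  idcast e ⊗m idm Z = idcast (f_equal (fun W => W ⊗ Z) e).
Proof. by case: Y / e; rewrite tensm_id. Qed.

Lemma tensm_idcastr X Y Z (e : X = Y) :
  idm Z ⊗m idcast e = idcast (f_equal (tens Z) e).
Proof. by case: Y / e; rewrite tensm_id. Qed.

Lemma tensm_compl X X' X'' Y (f : hom X' X'') (g : hom X X') :
  (f ∘ g) ⊗m idm Y = (f ⊗m idm Y) ∘ (g ⊗m idm Y).
Proof. by rewrite -tensm_comp comp1m. Qed.

Lemma tensm_compr X X' X'' Y (f : hom X' X'') (g : hom X X') :
  idm Y ⊗m (f ∘ g) = (idm Y ⊗m f) ∘ (idm Y ⊗m g).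
Proof. by rewrite -tensm_comp comp1m. Qed.

Lemma ascK X Y Z : ascV X Y Z ∘ asc X Y Z = idm (X ⊗ Y ⊗ Z).
Proof. by rewrite /asc /ascV; case: _ / (tensA X Y Z); rewrite comp1m. Qed.

Lemma ascVK X Y Z : asc X Y Z ∘ ascV X Y Z = idm (X ⊗ (Y ⊗ Z)).
Proof. by rewrite /asc /ascV; case: _ / (tensA X Y Z); rewrite comp1m. Qed.

Lemma tensr_comp X Y Z (f g : hom (Y ⊗ Z) (Y ⊗ Z)) :
  tensr X (f ∘ g) = tensr X f ∘ tensr X g.
Proof.
by rewrite /tensr tensm_compr !compA -(compA _ (asc _ _ _)) ascVK compm1.
Qed.

Lemma tensr_id X Y Z : tensr X (idm (Y ⊗ Z)) = idm (X ⊗ Y ⊗ Z).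
Proof. by rewrite /tensr tensm_id compm1 ascK. Qed.

Lemma asc_tensr X Y Z (f : hom (Y ⊗ Z) (Y ⊗ Z)) :
  asc X Y Z ∘ tensr X f = (idm X ⊗m f) ∘ asc X Y Z.
Proof. by rewrite /tensr !compA ascVK comp1m. Qed.

(** The companions carry [T] past the multiplications: in strict notation, [μT(μT ⊗ A) = μ(μ ⊗ A) T2
    (A ⊗ T)(T ⊗ A) = μ(A ⊗ μ) T1 (T ⊗ A)(A ⊗ T) = μT(A ⊗ μT)]. *)
Lemma pseudotwistor_algebra (A : C) (mu : hom (A ⊗ A) A) (u : hom one A)
    (T : hom (A ⊗ A) (A ⊗ A)) :
  is_algebra mu u -> is_pseudotwistor mu u T -> is_algebra (mu ∘ T) u.
Proof.
case=> muA mu1m mum1 [Tu1 T1u [T1 [T2 [comp1 comp2 comp12]]]]; split.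
(* Generalizing [tensr A T] keeps [compA] from reassociating inside its definition. *)
- move: (tensr A T) (asc_tensr A T) comp2 comp12 => TT ascT comp2 comp12.
  rewrite tensm_compl tensm_compr !compA -(compA mu) -comp2.
  rewrite !compA muA -!compA (compA T2) -comp12 !compA.
  rewrite -(compA _ (_ ⊗m T) (asc A A A)) -ascT.
  by move: comp1 => /(f_equal (comp mu)); rewrite !compA => ->.
- by rewrite -compA Tu1.
- by rewrite -compA T1u.
Qed.

Variable c : braiding C.

(** Since [run] is natural and invertible, the claim may be checked after tensoring with [one] on
    the right. *)
Lemma lun_braid X : lun X ∘ c X one = run X.
Proof.
apply: (iso_epic (idcast_iso (tenso1 (X ⊗ one)))).
rewrite -tensm1 tensm_compl compA -/(run X).
suff -> : run X ∘ (lun X ⊗m idm one) ∘ (c X one ⊗m idm one)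
          = run X ∘ run (X ⊗ one) by [].
(* The extra [c X one] supplies the second factor of the hexagon for [X], [one], [one]. Naturality
   along [lun one] then turns [c X (one ⊗ one)] back into [c X one]. *)
rewrite -compA; congr (_ ∘ _); apply: (iso_monic (braid_iso c X one)).
have -> : lun X ⊗m idm one = lun (X ⊗ one) ∘ asc one X one.
  by rewrite tensm_idcastl idcast_comp; apply: idcast_irrelevance.
rewrite !compA /lun -tens1m -(compA (idcast _)) -(compA (idcast _)).
rewrite -braid_hexagonr !compA.
have -> : idcast (tens1o (one ⊗ X)) ∘ asc one one X = lun one ⊗m idm X.
  by rewrite tensm_idcastl idcast_comp; apply: idcast_irrelevance.
rewrite -braid_nat -compA; congr (_ ∘ _).
by rewrite tensm_idcastr idcast_comp; apply: idcast_irrelevance.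
Qed.

(** Mirror image of [lun_braid], with the other hexagon. *)
Lemma run_braid X : run X ∘ c one X = lun X.
Proof.
apply: (iso_epic (idcast_iso (tens1o (one ⊗ X)))).
rewrite -tens1m tensm_compr compA -/(lun X).
suff -> : lun X ∘ (idm one ⊗m run X) ∘ (idm one ⊗m c one X)
          = lun X ∘ lun (one ⊗ X) by [].
rewrite -compA; congr (_ ∘ _); apply: (iso_monic (braid_iso c one X)).
have -> : idm one ⊗m run X = run (one ⊗ X) ∘ ascV one X one.
  by rewrite tensm_idcastr idcast_comp; apply: idcast_irrelevance.
rewrite !compA /run -tensm1 -(compA (idcast _)) -(compA (idcast _)).
rewrite -braid_hexagonl !compA.
have -> : idcast (tenso1 (X ⊗ one)) ∘ ascV X one one = idm X ⊗m lun one.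
  by rewrite tensm_idcastr idcast_comp; apply: idcast_irrelevance.
rewrite -braid_nat -compA; congr (_ ∘ _).
by rewrite tensm_idcastl idcast_comp; apply: idcast_irrelevance.
Qed.

Lemma double_braid1m X : c X one ∘ c one X = idm (one ⊗ X).
Proof.
apply: (iso_monic (idcast_iso (tens1o X))).
by rewrite compA compm1 lun_braid run_braid.
Qed.

Lemma double_braidm1 X : c one X ∘ c X one = idm (X ⊗ one).
Proof.
apply: (iso_monic (idcast_iso (tenso1 X))).
by rewrite compA compm1 run_braid lun_braid.
Qed.

Section BraidRelation.

Variable A : C.
Local Notation s1 := (c A A ⊗m idm A).
Local Notation s2 := (tensr A (c A A)).

Lemma braid_tensr : c A (A ⊗ A) ∘ asc A A A = s2 ∘ s1.
Proof.
apply: (iso_monic (idcast_iso (tensA A A A))).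
by rewrite -/(asc A A A) [RHS]compA asc_tensr -braid_hexagonr compA.
Qed.

Lemma braid_tensl : c (A ⊗ A) A = asc A A A ∘ s1 ∘ s2.
Proof.
apply: (iso_epic (idcast_iso (eq_sym (tensA A A A)))).
apply: (iso_monic (idcast_iso (eq_sym (tensA A A A)))).
rewrite -/(ascV A A A) compA braid_hexagonl.
by rewrite /tensr !compA ascK comp1m -[RHS]compA ascVK compm1.
Qed.

(** By the hexagon, [s2 ∘ s1] braids [A] past [A ⊗ A]; naturality slides the crossing [c A A] of the
    latter through it. *)
Lemma braid_relation : s1 ∘ s2 ∘ s1 = s2 ∘ s1 ∘ s2.
Proof.
rewrite -compA -braid_tensr compA -braid_nat -compA -asc_tensr.
by rewrite compA braid_tensr.
Qed.

Lemma braid_companions : exists T1 T2 : hom (A ⊗ A ⊗ A) (A ⊗ A ⊗ A),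
  [/\ T1 ∘ ((c A A ∘ c A A) ⊗m idm A) = s1 ∘ s2 ∘ s2 ∘ s1,
      T2 ∘ tensr A (c A A ∘ c A A) = s2 ∘ s1 ∘ s1 ∘ s2
    & T1 ∘ ((c A A ∘ c A A) ⊗m idm A) ∘ tensr A (c A A ∘ c A A)
      = T2 ∘ tensr A (c A A ∘ c A A) ∘ ((c A A ∘ c A A) ⊗m idm A)].
Proof.
case: (braid_iso c A A) => d [dc _].
have s1K : (d ⊗m idm A) ∘ s1 = idm (A ⊗ A ⊗ A).
  by rewrite -tensm_compl dc tensm_id.
have s2K : tensr A d ∘ s2 = idm (A ⊗ A ⊗ A).
  by rewrite -tensr_comp dc tensr_id.
rewrite tensm_compl tensr_comp.
(* What remains is a word computation from the braid relation and the left inverses [r1], [r2]. *)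
move: s1 s2 (d ⊗m idm A) (tensr A d) s1K s2K braid_relation.
move=> t1 t2 r1 r2 t1K t2K br.
have E1 : t1 ∘ t2 ∘ t2 ∘ r1 ∘ (t1 ∘ t1) = t1 ∘ t2 ∘ t2 ∘ t1.
  by rewrite compA -(compA _ r1 t1) t1K compm1.
have E2 : t2 ∘ t1 ∘ t1 ∘ r2 ∘ (t2 ∘ t2) = t2 ∘ t1 ∘ t1 ∘ t2.
  by rewrite compA -(compA _ r2 t2) t2K compm1.
exists (t1 ∘ t2 ∘ t2 ∘ r1), (t2 ∘ t1 ∘ t1 ∘ r2); split=> //.
rewrite E1 E2.
have -> : t1 ∘ t2 ∘ t2 ∘ t1 ∘ (t2 ∘ t2) = t1 ∘ t2 ∘ (t2 ∘ t1 ∘ t2) ∘ t2.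
  by rewrite !compA.
have -> : t2 ∘ t1 ∘ t1 ∘ t2 ∘ (t1 ∘ t1) = t2 ∘ t1 ∘ (t1 ∘ t2 ∘ t1) ∘ t1.
  by rewrite !compA.
(* Flipping both inner triples leaves the alternating words [(t1 t2)^3] and [(t2 t1)^3], which agree
   by applying [br] to each half. *)
by rewrite -{1}br {2}br !compA br -!compA; do 3!congr (_ ∘ _); rewrite !compA br.
Qed.

End BraidRelation.
End StrictMonoidal.

Theorem corollary6p8 (C : strictMonoidalCat) (c : braiding C) (A : C)
    (mu : hom (A ⊗ A) A) (u : hom one A) (hA : is_algebra mu u) :
  is_pseudotwistor mu u (c A A ∘ c A A)
  /\ is_algebra (mu ∘ (c A A ∘ c A A)) u.
Proof.
suff tw : is_pseudotwistor mu u (c A A ∘ c A A).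
  by split=> //; apply: pseudotwistor_algebra.
split.
(* Naturality moves [u] out through both braidings, leaving the double braiding of [A] with
   [one]. *)
- by rewrite -compA braid_nat compA braid_nat -compA double_braid1m compm1.
- by rewrite -compA braid_nat compA braid_nat -compA double_braidm1 compm1.
- have [T1 [T2 [E1 E2 E12]]] := braid_companions c A.
  have cr := braid_tensr c A; have cl := braid_tensl c A.
  exists T1, T2; split=> //.
  (* Pulling [mu] through both braidings leaves [c (A ⊗ A) A] after [c A (A ⊗ A)]; for the second
     companion the two come in the opposite order. *)
  + rewrite -compA E1; move: (tensr A (c A A)) cr cl => s2 cr cl.
    rewrite -(compA _ _ (_ ⊗m mu)) braid_nat !compA braid_nat.
    by rewrite -(compA _ _ (asc _ _ _)) cr cl !compA.
  + rewrite -compA E2; move: (tensr A (c A A)) cr cl => s2 cr cl.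
    rewrite -(compA _ _ (mu ⊗m _)) braid_nat !compA braid_nat cl.
    by rewrite !compA -(compA _ _ (asc _ _ _)) cr !compA.
Qed.
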